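(* Let $G$ be the Bass-Serre fundamental group of a finite connected graph of groups all of whose vertex and edge groups are $\mathbf{Z}^n$, let $\iota:G\to\mathrm{Aut}(\tilde X)$ be the action on the associated Bass-Serre tree $\tilde X$, and let $\mu:G\to\mathbf{R}^n\rtimes\mathrm{GL}_n(\mathbf{R})$ be the homomorphism described in the context. Then the homomorphism $$G\to\overline{\iota(G)}\times(\mathbf{R}^n\rtimes \mu(H_d)),\qquad g\mapsto(\iota(g),\mu(g)),$$ is proper (i.e. the preimage of every compact subset is finite, $G$ being discrete).
   Context: Graphs (in the sense of Serre): $X=(V,E)$ with vertex set $V$, oriented edge set $E$, fixed-point-free involution $e\mapsto\bar e$ on $E$, and origin/extremity maps $e\mapsto e_-,e_+$ with $\bar e_+=e_-$. Setting: $X$ is finite and connected, $n\ge 1$; every vertex group $G_v$ and edge group $G_e=G_{\bar e}$ equals $\mathbf{Z}^n$; for $e\in E$ there is an injective homomorphism $\sigma_e:G_e\to G_{e_+}$, viewed as an integer $n\times n$ matrix with nonzero determinant. Fix a maximal tree $T$ in $X$, an orientation $A\subset E$ (exactly one edge of each pair $\{e,\bar e\}$), and a base vertex $v_0$. The group $G$ is generated by the groups $G_v$ ($v\in V$) and letters $t_e$ ($e\in E$) subject to the relations of the $G_v$ and $t_e\sigma_e(g)t_e^{-1}=\sigma_{\bar e}(g)$ ($e\in E$, $g\in G_e$), $t_et_{\bar e}=1$ ($e\in E$), $t_e=1$ ($e$ an edge of $T$). Put $d=|A\smallsetminus T|$ and let $H_d\subset G$ be the subgroup generated by $\{t_e:e\in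 A\smallsetminus T\}$, which is free of rank $d$. Homomorphism $\mu$: let $(\tau_v)_{v\in V}$ be the unique family in $\mathrm{GL}_n(\mathbf{Q})$ with $\tau_{v_0}=1$ and $\tau_{e_-}\sigma_{\bar e}=\tau_{e_+}\sigma_e$ for every edge $e$ of $A\cap T$. Then $\mu:G\to\mathbf{R}^n\rtimes\mathrm{GL}_n(\mathbf{R})$ sends $g\in G_v=\mathbf{Z}^n$ to the translation by $\tau_v(g)$, and $t_e$ ($e\in A\smallsetminus T$) to $\mu(t_e)=\tau_{e_-}\sigma_{\bar e}\sigma_e^{-1}\tau_{e_+}^{-1}\in\mathrm{GL}_n(\mathbf{R})$. The Bass-Serre tree $\tilde X$ is locally finite; $\mathrm{Aut}(\tilde X)$ carries the topology of pointwise convergence and $\overline{\iota(G)}$ is the closure of $\iota(G)$ in it. The group $\mu(H_d)$ is given the discrete topology, so that $\mathbf{R}^n\rtimes\mu(H_d)$ is a (non-connected) Lie group. *)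

(* Defs.v *)
From HB Require Import structures.
From mathcomp Require Import all_boot all_order all_algebra.
From mathcomp Require Import all_classical all_reals all_analysis.

Set Implicit Arguments.
Unset Strict Implicit.
Unset Printing Implicit Defensive.

Import Order.TTheory GRing.Theory Num.Theory.
Import numFieldNormedType.Exports.
Local Open Scope classical_set_scope.
Local Open Scope ring_scope.
Local Open Scope quotient_scope.

(* Graphs in the sense of Serre; org e and ext e are written e_- and e_+ in
   the literature. The same type serves for the finite graph X and for its
   (infinite) Bass-Serre tree. *)
Record sgraph := SGraph {
  vert : choiceType;
  edge : choiceType;
  bar : edge -> edge;
  org : edge -> vert;
  ext : edge -> vert;
  barK : involutive bar;
  bar_neq : forall e, bar e <> e;
  ext_bar : forall e, ext (bar e) = org e
}.

Section Graphs.
Variable X : sgraph.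
Implicit Types (W : set (vert X)) (F A : set (edge X)).

Fixpoint walk (u w : vert X) (c : seq (edge X)) : Prop :=
  if c is e :: c' then org e = u /\ walk (ext e) w c' else u = w.

(* A circuit is a subgraph isomorphic to the cyclic graph on k >= 1 vertices,
   given by its k consecutive edges: a loop when k = 1, a pair of distinct
   geometric edges with the same ends when k = 2. *)
Definition circuit (c : seq (edge X)) : Prop :=
  [/\ c != [::],
      cycle [rel e f | (ext e == org f) && (f != bar e)] c &
      uniq [seq org e | e <- c]].

Definition is_subgraph W F : Prop :=
  forall e, F e -> F (bar e) /\ W (org e).

Definition is_connected W F : Prop :=
  W !=set0 /\
  forall u w, W u -> W w -> exists2 c, {in c, forall e, F e} & walk u w c.

Definition is_tree W F : Prop :=
  [/\ is_subgraph W F, is_connected W F &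
      forall c, circuit c -> ~ {in c, forall e, F e}].

(* F is the edge set of a subtree that is maximal among all subtrees. *)
Definition maximal_tree F : Prop :=
  exists2 W, is_tree W F & forall W' F', is_tree W' F' ->
    W `<=` W' -> F `<=` F' -> W' = W /\ F' = F.

Definition connected_graph : Prop := is_connected [set: vert X] [set: edge X].

Definition finite_graph : Prop :=
  finite_set [set: vert X] /\ finite_set [set: edge X].

Definition orientation A : Prop := forall e, A e <-> ~ A (bar e).

Lemma org_bar (e : edge X) : org (bar e) = ext e.
Proof. by rewrite -ext_bar barK. Qed.

Lemma maximal_tree_bar F e : maximal_tree F -> F e -> F (bar e).
Proof. by case=> W [sF _ _] _ /sF[]. Qed.

End Graphs.

Section PresentedGroup.
Variables (S : choiceType) (rels : seq (S * bool) -> seq (S * bool) -> Prop).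

(* (s, true) stands for the letter s and (s, false) for its inverse. *)
Local Notation word := (seq (S * bool)).

Inductive pres_eq : word -> word -> Prop :=
| PresRefl u : pres_eq u u
| PresSym u v : pres_eq u v -> pres_eq v u
| PresTrans u v w : pres_eq u v -> pres_eq v w -> pres_eq u w
| PresCat u v u' v' : pres_eq u v -> pres_eq u' v' -> pres_eq (u ++ u') (v ++ v')
| PresInv s b : pres_eq [:: (s, b); (s, ~~ b)] [::]
| PresRel u v : rels u v -> pres_eq u v.

Definition pres_eqb (u v : word) : bool := `[< pres_eq u v >].

Lemma pres_eqb_refl : reflexive pres_eqb.
Proof. by move=> u; apply/asboolP; exact: PresRefl. Qed.
Lemma pres_eqb_sym : symmetric pres_eqb.
Proof. by move=> u v; apply/asboolP/asboolP => /PresSym. Qed.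
Lemma pres_eqb_trans : transitive pres_eqb.
Proof.
by move=> v u w /asboolP uv /asboolP vw; apply/asboolP; exact: PresTrans vw.
Qed.

Canonical pres_equiv := EquivRel pres_eqb pres_eqb_refl pres_eqb_sym pres_eqb_trans.

Definition pres_group := {eq_quot pres_equiv}.
HB.instance Definition _ := Choice.on pres_group.

Definition pres_class (u : word) : pres_group := \pi_pres_group u.
Definition pres_gen (s : S) : pres_group := pres_class [:: (s, true)].

Lemma pres_classP (u v : word) : pres_class u = pres_class v <-> pres_eq u v.
Proof.
split; first by move/eqmodP => /asboolP.
by move=> uv; apply/eqmodP/asboolP.
Qed.

Lemma pres_classE (x : pres_group) : pres_class (repr x) = x.
Proof. by rewrite /pres_class reprK. Qed.

Definition word_inv (u : word) : word := rev [seq (a.1, ~~ a.2) | a <- u].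

Definition pres_mul (x y : pres_group) := pres_class (repr x ++ repr y).
Definition pres_inv (x : pres_group) := pres_class (word_inv (repr x)).
Definition pres_one : pres_group := pres_class [::].

Lemma pres_repr (u : word) : pres_eq (repr (pres_class u)) u.
Proof. by apply/pres_classP; rewrite pres_classE. Qed.

Lemma pres_mulE u v : pres_mul (pres_class u) (pres_class v) = pres_class (u ++ v).
Proof. by apply/pres_classP; apply: PresCat; exact: pres_repr. Qed.

Lemma word_invr u : pres_eq (u ++ word_inv u) [::].
Proof.
elim: u => [|[s b] u IH]; first exact: PresRefl.
rewrite /word_inv /= rev_cons -cats1 -/(word_inv u) catA.
apply: (PresTrans (v := [:: (s, b); (s, ~~ b)])); last exact: PresInv.
have := PresCat (PresCat (PresRefl [:: (s, b)]) IH) (PresRefl [:: (s, ~~ b)]).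
by rewrite cats0.
Qed.

Lemma word_invK : involutive word_inv.
Proof.
move=> u; rewrite /word_inv map_rev revK -map_comp -[RHS]map_id.
by apply: eq_map => -[s b] /=; rewrite negbK.
Qed.

Lemma word_invl u : pres_eq (word_inv u ++ u) [::].
Proof. by have := word_invr (word_inv u); rewrite word_invK. Qed.

Lemma pres_mulA : associative pres_mul.
Proof.
move=> x y z; rewrite -[x]pres_classE -[y]pres_classE -[z]pres_classE.
by rewrite !pres_mulE catA.
Qed.
Lemma pres_mul1 : left_id pres_one pres_mul.
Proof. by move=> x; rewrite -[x]pres_classE pres_mulE. Qed.
Lemma pres_mulr1 : right_id pres_one pres_mul.
Proof. by move=> x; rewrite -[x]pres_classE pres_mulE cats0. Qed.
Lemma pres_mulV : left_inverse pres_one pres_inv pres_mul.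
Proof.
move=> x; rewrite -{2}[x]pres_classE pres_mulE.
by apply/pres_classP; exact: word_invl.
Qed.
Lemma pres_mulrV : right_inverse pres_one pres_inv pres_mul.
Proof.
move=> x; rewrite -{1}[x]pres_classE pres_mulE.
by apply/pres_classP; exact: word_invr.
Qed.

HB.instance Definition _ := isGroup.Build pres_group
  pres_mulA pres_mul1 pres_mulr1 pres_mulV pres_mulrV.

Lemma pres_classM u v : pres_class (u ++ v) = (pres_class u * pres_class v)%g.
Proof. by rewrite -pres_mulE. Qed.

Lemma pres_class_inv s : pres_class [:: (s, false)] = (pres_gen s)^-1%g.
Proof.
apply/esym; apply: mulg1_eq.
by rewrite -pres_classM; apply/pres_classP; exact: (PresInv s true).
Qed.

Section Lift.
Variables (K : groupType) (f : S -> K).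

Definition word_eval (u : word) : K :=
  (\prod_(a <- u) (if a.2 then f a.1 else (f a.1)^-1))%g.

Hypothesis f_rels : forall u v, rels u v -> word_eval u = word_eval v.

Lemma word_eval_cat u v : word_eval (u ++ v) = (word_eval u * word_eval v)%g.
Proof. by rewrite /word_eval big_cat. Qed.

Lemma word_eval_eq u v : pres_eq u v -> word_eval u = word_eval v.
Proof.
elim=> {u v} [//|//|u v w _ -> _ -> //|u v u' v' _ uv _ uv'|s b|u v].
- by rewrite !word_eval_cat uv uv'.
- rewrite /word_eval !big_cons big_nil /= Monoid.mulm1.
  by case: b; rewrite /= ?mulgV ?mulVg.
- exact: f_rels.
Qed.

Definition pres_lift (x : pres_group) : K := word_eval (repr x).

Lemma pres_liftE u : pres_lift (pres_class u) = word_eval u.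
Proof. by apply: word_eval_eq; exact: pres_repr. Qed.

Lemma pres_lift_gen s : pres_lift (pres_gen s) = f s.
Proof. by rewrite pres_liftE /word_eval big_cons big_nil /= Monoid.mulm1. Qed.

Lemma pres_lift_morphism : monoid.monoid_morphism pres_lift.
Proof.
split; first by rewrite -[1%g]/(pres_class [::]) pres_liftE /word_eval big_nil.
move=> x y; rewrite -[x]pres_classE -[y]pres_classE -pres_classM !pres_liftE.
exact: word_eval_cat.
Qed.

End Lift.
End PresentedGroup.

Section Subgroups.
Variable G : groupType.
Implicit Types (H S : set G).

Definition is_subgroup H : Prop :=
  [/\ H 1%g, forall x y, H x -> H y -> H (x * y)%g & forall x, H x -> H x^-1%g].

Definition generated S : set G :=
  [set x | forall H, is_subgroup H -> S `<=` H -> H x].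

Lemma generated_subgroup S : is_subgroup (generated S).
Proof.
split=> [H [] //|x y Sx Sy H HH SH|x Sx H HH SH]; have [? HM HV] := HH.
  by apply: HM; [exact: Sx|exact: Sy].
by apply: HV; exact: Sx.
Qed.

Lemma sub_generated S : S `<=` generated S.
Proof. by move=> x Sx H _; apply. Qed.

Definition setM S T : set G := [set (x * y)%g | x in S & y in T].
Definition lcoset (x : G) H : set G := [set (x * h)%g | h in H].
Definition rtrans S (x : G) : set G := [set (s * x)%g | s in S].

Lemma lcosetM x y H : lcoset (x * y)%g H = lcoset x (lcoset y H).
Proof.
apply/seteqP; split=> z /=.
  by case=> h Hh <-; exists (y * h)%g; [exists h|rewrite mulgA].
by case=> _ [h Hh <-] <-; exists h => //; rewrite mulgA.
Qed.

Lemma lcoset1 S : lcoset 1%g S = S.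
Proof.
apply/seteqP; split=> z /=; first by case=> h Hh <-; rewrite mul1g.
by move=> Sz; exists z => //; rewrite mul1g.
Qed.

Lemma rtransM S x y : rtrans (rtrans S x) y = rtrans S (x * y)%g.
Proof.
apply/seteqP; split=> z /=.
  by case=> _ [h Hh <-] <-; exists h => //; rewrite mulgA.
by case=> h Hh <-; exists (h * x)%g; [exists h|rewrite mulgA].
Qed.

Lemma rtrans1 S : rtrans S 1%g = S.
Proof.
apply/seteqP; split=> z /=; first by case=> h Hh <-; rewrite mulg1.
by move=> Sz; exists z => //; rewrite mulg1.
Qed.

Lemma lcoset_setM x S T : lcoset x (setM S T) = setM (lcoset x S) T.
Proof.
apply/seteqP; split=> z /=.
  case=> _ [s Ss [t Tt <-]] <-; exists (x * s)%g; first by exists s.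
  by exists t; rewrite ?mulgA.
case=> _ [s Ss <-] [t Tt <-]; exists (s * t)%g; last by rewrite mulgA.
by exists s => //; exists t.
Qed.

Lemma lcoset_rtrans x S y : lcoset x (rtrans S y) = rtrans (lcoset x S) y.
Proof.
apply/seteqP; split=> z /= [_ [s Ss <-] <-].
  by exists (x * s)%g; [exists s|rewrite mulgA].
by exists (s * y)%g; [exists s|rewrite mulgA].
Qed.

End Subgroups.

(* Graphs of groups all of whose vertex and edge groups are Z^n, the elements
   of Z^n being column vectors; sg e : G_e -> G_{e_+} is sigma_e. *)
Record Zn_graph (n : nat) := ZnGraph {
  gr :> sgraph;
  sg : edge gr -> 'M[int]_n;
  det_sg : forall e, \det (sg e) != 0
}.

Section FundamentalGroup.
Variables (n : nat) (X : Zn_graph n) (T : set (edge X)).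

Definition letter : choiceType := ((vert X * 'cV[int]_n) + edge X)%type.

Definition vl (v : vert X) (x : 'cV[int]_n) : letter * bool := (inl (v, x), true).
Definition el (e : edge X) : letter * bool := (inr e, true).
Definition elV (e : edge X) : letter * bool := (inr e, false).

Inductive gog_rel : seq (letter * bool) -> seq (letter * bool) -> Prop :=
| RelVertex v x y : gog_rel [:: vl v x; vl v y] [:: vl v (x + y)]
| RelEdge e x : gog_rel [:: el e; vl (ext e) (sg e *m x); elV e]
                        [:: vl (org e) (sg (bar e) *m x)]
| RelInv e : gog_rel [:: el e; el (bar e)] [::]
| RelTree e : T e -> gog_rel [:: el e] [::].

Definition fund_group := pres_group gog_rel.
HB.instance Definition _ := monoid.Group.on fund_group.

Definition gv (v : vert X) (x : 'cV[int]_n) : fund_group :=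
  pres_gen gog_rel (inl (v, x)).
Definition gt (e : edge X) : fund_group := pres_gen gog_rel (inr e).

Lemma gvD v x y : gv v (x + y) = (gv v x * gv v y)%g.
Proof.
by apply/esym; rewrite /gv -pres_classM; apply/pres_classP/PresRel/RelVertex.
Qed.

Lemma gt_bar e : gt (bar e) = (gt e)^-1%g.
Proof.
apply/esym; apply: mulg1_eq; rewrite /gt -pres_classM.
by apply/pres_classP/PresRel/RelInv.
Qed.

Lemma gt_conj e x :
  (gt e * gv (ext e) (sg e *m x) * (gt e)^-1)%g = gv (org e) (sg (bar e) *m x).
Proof.
have /PresRel/pres_classP := RelEdge e x; apply: etrans.
rewrite -[[:: _; _; _]]/([:: el e] ++ [:: vl _ _] ++ [:: elV e]).
by rewrite !pres_classM mulgA pres_class_inv.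
Qed.

Lemma gt_tree e : T e -> gt e = 1%g.
Proof. by move=> Te; apply/pres_classP/PresRel/RelTree. Qed.

(* Images in G of G_v, and of G_e under sigma_{bar e} : G_e -> G_{e_-}. *)
Definition Gv (v : vert X) : set fund_group := range (gv v).
Definition Ge (e : edge X) : set fund_group :=
  range (fun x => gv (org e) (sg (bar e) *m x)).

Lemma GeE e : rtrans (Ge e) (gt e) = lcoset (gt e) (Ge (bar e)).
Proof.
apply/seteqP; split=> z /=.
  case=> _ [x _ <-] <-; exists (gv (ext e) (sg e *m x)).
    by exists x => //; rewrite org_bar barK.
  by rewrite -gt_conj -mulgA mulVg mulg1.
case=> _ [x _ <-] <-; rewrite org_bar barK.
exists (gv (org e) (sg (bar e) *m x)); first by exists x.
by rewrite -gt_conj -mulgA mulVg mulg1.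
Qed.

Lemma gv0 v : gv v 0 = 1%g.
Proof. by apply: (@mulgI _ (gv v 0)); rewrite -gvD addr0 mulg1. Qed.

Lemma Ge_setM e : setM (Ge e) (Gv (org e)) = Gv (org e).
Proof.
apply/seteqP; split=> z /=.
  by case=> _ [x _ <-] [_ [y _ <-] <-]; exists (sg (bar e) *m x + y) => //; rewrite gvD.
case=> x _ <-; exists 1%g; first by exists 0 => //; rewrite mulmx0 gv0.
by exists (gv (org e) x); [exists x|rewrite mul1g].
Qed.

(* The Bass-Serre tree: its vertices are the cosets in the disjoint union of
   the G/G_v, its oriented edges those in the disjoint union of the
   G/sigma_{bar e}(G_e). The edge g sigma_{bar e}(G_e) goes from g G_{e_-} to
   g t_e G_{e_+}, and its opposite is g t_e sigma_e(G_e). *)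
Definition bs_vertS : set (vert X * set fund_group) :=
  [set p | exists g, p.2 = lcoset g (Gv p.1)].
Definition bs_edgeS : set (edge X * set fund_group) :=
  [set p | exists g, p.2 = lcoset g (Ge p.1)].

Definition bs_vert : choiceType := set_type bs_vertS.
Definition bs_edge : choiceType := set_type bs_edgeS.

Lemma bs_bar_subproof (x : bs_edge) :
  bs_edgeS (bar (val x).1, rtrans (val x).2 (gt (val x).1)).
Proof.
have [g /= ->] := set_valP x; exists (g * gt (val x).1)%g => /=.
by rewrite -lcoset_rtrans GeE lcosetM.
Qed.
Definition bs_bar (x : bs_edge) : bs_edge := SigSub (mem_set (bs_bar_subproof x)).

Lemma bs_org_subproof (x : bs_edge) :
  bs_vertS (org (val x).1, setM (val x).2 (Gv (org (val x).1))).
Proof.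
have [g /= ->] := set_valP x; exists g => /=.
by rewrite -lcoset_setM Ge_setM.
Qed.
Definition bs_org (x : bs_edge) : bs_vert := SigSub (mem_set (bs_org_subproof x)).

Lemma bs_ext_subproof (x : bs_edge) :
  bs_vertS (ext (val x).1,
            setM (rtrans (val x).2 (gt (val x).1)) (Gv (ext (val x).1))).
Proof.
by have := bs_org_subproof (bs_bar x); rewrite /= org_bar.
Qed.
Definition bs_ext (x : bs_edge) : bs_vert := SigSub (mem_set (bs_ext_subproof x)).

Lemma bs_barK : involutive bs_bar.
Proof.
move=> x; apply: val_inj => /=; rewrite barK rtransM gt_bar mulgV rtrans1.
by case: (val x).
Qed.

Lemma bs_bar_neq x : bs_bar x <> x.
Proof. by move/(congr1 val)/(congr1 fst) => /= /bar_neq. Qed.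

Lemma bs_ext_bar x : bs_ext (bs_bar x) = bs_org x.
Proof.
by apply: val_inj => /=; rewrite ext_bar rtransM gt_bar mulgV rtrans1.
Qed.

Definition bs_tree : sgraph := SGraph bs_barK bs_bar_neq bs_ext_bar.

End FundamentalGroup.

Section GraphAutomorphisms.
Variable X : sgraph.

(* Pointwise convergence on the discrete sets of vertices and edges. *)
Definition graph_maps : topologicalType :=
  ({ptws vert X -> discrete_topology (vert X)} *
   {ptws edge X -> discrete_topology (edge X)})%type.

Definition is_graph_aut : set graph_maps :=
  [set p | [/\ bijective p.1, bijective p.2,
               forall e, org (p.2 e) = p.1 (org e),
               forall e, ext (p.2 e) = p.1 (ext e) &
               forall e, bar (p.2 e) = p.2 (bar e)]].

(* The topology of set_type is the one induced from graph_maps. *)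
Definition graph_aut : Type := set_type is_graph_aut.
HB.instance Definition _ := Topological.on graph_aut.
HB.instance Definition _ := SubType.on graph_aut.

Definition aut_vert (p : graph_aut) : vert X -> vert X := (val p).1.
Definition aut_edge (p : graph_aut) : edge X -> edge X := (val p).2.

Lemma aut_mul_subproof (p q : graph_aut) :
  is_graph_aut (aut_vert p \o aut_vert q, aut_edge p \o aut_edge q).
Proof.
have [p1 p2 po pe pb] := set_valP p; have [q1 q2 qo qe qb] := set_valP q.
split=> /=; [exact: bij_comp|exact: bij_comp|move=> e..].
- by rewrite /aut_vert /aut_edge po qo.
- by rewrite /aut_vert /aut_edge pe qe.
- by rewrite /aut_edge pb qb.
Qed.
Definition aut_mul (p q : graph_aut) : graph_aut :=
  SigSub (mem_set (aut_mul_subproof p q)).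

Lemma aut_one_subproof : is_graph_aut (idfun, idfun).
Proof. by split=> //; exists idfun. Qed.
Definition aut_one : graph_aut := SigSub (mem_set aut_one_subproof).

Lemma aut_mulA : associative aut_mul.
Proof. by move=> p q r; apply: val_inj. Qed.
Lemma aut_mul1 : left_id aut_one aut_mul.
Proof. by case=> -[f h] p; exact: val_inj. Qed.
Lemma aut_mulr1 : right_id aut_one aut_mul.
Proof. by case=> -[f h] p; exact: val_inj. Qed.

Lemma aut_inv_subproof (p : graph_aut) :
  exists q, aut_mul q p = aut_one /\ aut_mul p q = aut_one.
Proof.
have [[f fK Kf] [h hK Kh] po pe pb] := set_valP p.
have qP : is_graph_aut (f, h).
  split=> /=; [by exists (val p).1|by exists (val p).2|move=> e..].
  - by rewrite -{2}[e]Kh po fK.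
  - by rewrite -{2}[e]Kh pe fK.
  - by rewrite -{2}[e]Kh pb hK.
exists (SigSub (mem_set qP)); split; apply: val_inj; congr pair; apply: funext => x /=.
- exact: fK.
- exact: hK.
- exact: Kf.
- exact: Kh.
Qed.
Definition aut_inv (p : graph_aut) : graph_aut := sval (cid (aut_inv_subproof p)).

Lemma aut_mulV : left_inverse aut_one aut_inv aut_mul.
Proof. by move=> p; rewrite /aut_inv; case: cid => q []. Qed.
Lemma aut_mulrV : right_inverse aut_one aut_inv aut_mul.
Proof. by move=> p; rewrite /aut_inv; case: cid => q []. Qed.

HB.instance Definition _ := isGroup.Build graph_aut
  aut_mulA aut_mul1 aut_mulr1 aut_mulV aut_mulrV.

End GraphAutomorphisms.

Section TreeAction.
Variables (n : nat) (X : Zn_graph n) (T : set (edge X)).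
Local Notation G := (fund_group T).
Local Notation Xt := (bs_tree T).

Lemma act_vert_subproof (g : G) (x : bs_vert T) :
  bs_vertS ((val x).1, lcoset g (val x).2).
Proof. by have [h /= ->] := set_valP x; exists (g * h)%g; rewrite lcosetM. Qed.
Definition act_vert (g : G) (x : vert Xt) : vert Xt :=
  SigSub (mem_set (act_vert_subproof g x)).

Lemma act_edge_subproof (g : G) (x : bs_edge T) :
  bs_edgeS ((val x).1, lcoset g (val x).2).
Proof. by have [h /= ->] := set_valP x; exists (g * h)%g; rewrite lcosetM. Qed.
Definition act_edge (g : G) (x : edge Xt) : edge Xt :=
  SigSub (mem_set (act_edge_subproof g x)).

Lemma act_vertM g h x : act_vert (g * h)%g x = act_vert g (act_vert h x).
Proof. by apply: val_inj => /=; rewrite lcosetM. Qed.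
Lemma act_edgeM g h x : act_edge (g * h)%g x = act_edge g (act_edge h x).
Proof. by apply: val_inj => /=; rewrite lcosetM. Qed.
Lemma act_vert1 x : act_vert 1%g x = x.
Proof. by apply: val_inj => /=; rewrite lcoset1; case: (val x). Qed.
Lemma act_edge1 x : act_edge 1%g x = x.
Proof. by apply: val_inj => /=; rewrite lcoset1; case: (val x). Qed.

Lemma iota_subproof (g : G) : is_graph_aut (X := Xt) (act_vert g, act_edge g).
Proof.
split=> /=; last 3 first.
- by move=> e; apply: val_inj; rewrite /= lcoset_setM.
- by move=> e; apply: val_inj; rewrite /= -lcoset_rtrans lcoset_setM.
- by move=> e; apply: val_inj; rewrite /= lcoset_rtrans.
- exists (act_vert g^-1%g) => x.
    by rewrite -act_vertM mulVg act_vert1.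
  by rewrite -act_vertM mulgV act_vert1.
- exists (act_edge g^-1%g) => x.
    by rewrite -act_edgeM mulVg act_edge1.
  by rewrite -act_edgeM mulgV act_edge1.
Qed.

Definition bs_iota (g : G) : graph_aut Xt := SigSub (mem_set (iota_subproof g)).

Lemma bs_iota_morphism : monoid.monoid_morphism bs_iota.
Proof.
split=> [|g h]; apply: val_inj; congr pair; apply: funext => x.
- exact: act_vert1.
- exact: act_edge1.
- exact: act_vertM.
- exact: act_edgeM.
Qed.

End TreeAction.

Record GL (F : fieldType) (n : nat) :=
  MkGL { glmx :> 'M[F]_n ; glmxP : glmx \in unitmx }.
HB.instance Definition _ F n := [isSub for @glmx F n].
HB.instance Definition _ F n := [Choice of GL F n by <:].

Section GeneralLinearGroup.
Variables (F : fieldType) (n : nat).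
Implicit Types g h : GL F n.

Lemma gl_mul_subproof g h : g *m h \in unitmx.
Proof. by rewrite unitmx_mul !glmxP. Qed.
Definition gl_mul g h := MkGL (gl_mul_subproof g h).
Definition gl_one : GL F n := MkGL (unitmx1 F n).
Lemma gl_inv_subproof g : invmx g \in unitmx.
Proof. by rewrite unitmx_inv glmxP. Qed.
Definition gl_inv g := MkGL (gl_inv_subproof g).

Lemma gl_mulA : associative gl_mul.
Proof. by move=> f g h; apply: val_inj => /=; rewrite mulmxA. Qed.
Lemma gl_mul1 : left_id gl_one gl_mul.
Proof. by move=> g; apply: val_inj => /=; rewrite mul1mx. Qed.
Lemma gl_mulr1 : right_id gl_one gl_mul.
Proof. by move=> g; apply: val_inj => /=; rewrite mulmx1. Qed.
Lemma gl_mulV : left_inverse gl_one gl_inv gl_mul.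
Proof. by move=> g; apply: val_inj => /=; rewrite mulVmx ?glmxP. Qed.
Lemma gl_mulrV : right_inverse gl_one gl_inv gl_mul.
Proof. by move=> g; apply: val_inj => /=; rewrite mulmxV ?glmxP. Qed.

HB.instance Definition _ := isGroup.Build (GL F n)
  gl_mulA gl_mul1 gl_mulr1 gl_mulV gl_mulrV.
End GeneralLinearGroup.

Section GLmap.
Variables (F K : fieldType) (f : {rmorphism F -> K}) (n : nat).

Lemma gl_map_subproof (g : GL F n) : map_mx f g \in unitmx.
Proof. by rewrite map_unitmx glmxP. Qed.
Definition gl_map (g : GL F n) : GL K n := MkGL (gl_map_subproof g).

Lemma gl_map_morphism : monoid.monoid_morphism gl_map.
Proof.
by split=> [|g h]; apply: val_inj => /=; rewrite ?map_mx1 ?map_mxM.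
Qed.
End GLmap.

(* The group R^n ><| GL_n(R) of the maps x |-> lin x + trans. *)
Record affine (F : fieldType) (n : nat) :=
  Affine { trans : 'cV[F]_n ; lin : GL F n }.

Section AffineGroup.
Variables (F : fieldType) (n : nat).
Implicit Types a b c : affine F n.

Definition affine_pair a := (trans a, lin a).
Definition pair_affine (p : 'cV[F]_n * GL F n) := Affine p.1 p.2.
Lemma affine_pairK : cancel affine_pair pair_affine.
Proof. by case. Qed.
HB.instance Definition _ := Choice.copy (affine F n) (can_type affine_pairK).

Lemma affine_eq a b : trans a = trans b -> lin a = lin b -> a = b.
Proof. by case: a b => [x g] [y h] /= -> ->. Qed.

Definition affine_mul a b :=
  Affine (trans a + lin a *m trans b) (lin a * lin b)%g.
Definition affine_one : affine F n := Affine 0 1%g.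
Definition affine_inv a := Affine (- ((lin a)^-1%g *m trans a)) (lin a)^-1%g.

Lemma affine_mulA : associative affine_mul.
Proof.
move=> a b c; rewrite /affine_mul /=.
by congr Affine; rewrite ?mulgA // mulmxDr addrA mulmxA.
Qed.
Lemma affine_mul1 : left_id affine_one affine_mul.
Proof.
by case=> x g; rewrite /affine_mul /= add0r mul1g mul1mx.
Qed.
Lemma affine_mulr1 : right_id affine_one affine_mul.
Proof.
by case=> x g; rewrite /affine_mul /= mulmx0 addr0 mulg1.
Qed.
Lemma affine_mulV : left_inverse affine_one affine_inv affine_mul.
Proof.
by case=> x g; rewrite /affine_mul /affine_inv /= mulVg addNr.
Qed.
Lemma affine_mulrV : right_inverse affine_one affine_inv affine_mul.
Proof.
case=> x g; rewrite /affine_mul /affine_inv /= mulgV mulmxN mulmxA.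
by rewrite mulmxV ?glmxP // mul1mx subrr.
Qed.

HB.instance Definition _ := isGroup.Build (affine F n)
  affine_mulA affine_mul1 affine_mulr1 affine_mulV affine_mulrV.

Lemma affineM x y g h :
  (Affine x g * Affine y h)%g = Affine (x + g *m y) (g * h)%g.
Proof. by []. Qed.

Lemma affine_transM x y : (Affine x 1 * Affine y 1)%g = Affine (x + y) 1%g.
Proof. by rewrite affineM mul1mx mulg1. Qed.

Lemma affine_linM g h : (Affine 0 g * Affine 0 h)%g = Affine 0 (g * h)%g.
Proof. by rewrite affineM mulmx0 addr0. Qed.

Lemma affine_linV g : (Affine 0 g)^-1%g = Affine 0 g^-1%g.
Proof. by apply/mulg1_eq; rewrite affine_linM mulgV. Qed.

Lemma linM a b : lin (a * b)%g = (lin a * lin b)%g.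
Proof. by []. Qed.

Lemma affine_conj g x :
  (Affine 0 g * (Affine x 1 * (Affine 0 g)^-1))%g = Affine (g *m x) 1%g.
Proof.
by rewrite affine_linV !affineM mul1g mulgV !mulmx0 addr0 add0r.
Qed.
End AffineGroup.

Section Mu.
Variables (R : realType) (n : nat) (X : Zn_graph n).
Variables (T A : set (edge X)) (v0 : vert X) (tau : vert X -> GL rat n).
Local Notation G := (fund_group T).

Lemma sgQ_subproof (e : edge X) : map_mx (intr : int -> rat) (sg e) \in unitmx.
Proof. by rewrite unitmxE det_map_mx unitfE intr_eq0 det_sg. Qed.
Definition sgQ (e : edge X) : GL rat n := MkGL (sgQ_subproof e).

Definition glR (g : GL rat n) : GL R n := gl_map ratr g.

Definition tree_family : Prop :=
  tau v0 = 1%g /\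
  forall e, A e -> T e -> (tau (org e) * sgQ (bar e) = tau (ext e) * sgQ e)%g.

Definition mu_edge (e : edge X) : GL rat n :=
  (tau (org e) * sgQ (bar e) * (sgQ e)^-1 * (tau (ext e))^-1)%g.

(* The formula for mu(t_e), given for e in A \ T, makes sense for all e: it
   gives 1 on the edges of T and mu(t_e)^-1 for bar e (mu_edge_tree and
   mu_edge_bar below), as it must since mu is a homomorphism. *)
Definition mu_letter (l : letter X) : affine R n :=
  match l with
  | inl (v, x) =>
      Affine (glR (tau v) *m map_mx (intr : int -> R) x) 1%g
  | inr e => Affine 0 (glR (mu_edge e))
  end.

Definition mu : G -> affine R n := pres_lift mu_letter.

Hypotheses (maxT : maximal_tree T) (orA : orientation A) (tauP : tree_family).

Lemma mu_edge_bar e : mu_edge (bar e) = (mu_edge e)^-1%g.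
Proof.
by rewrite /mu_edge barK org_bar ext_bar !invgM !invgK !mulgA.
Qed.

Lemma mu_edge_tree e : T e -> mu_edge e = 1%g.
Proof.
have treeA f : A f -> T f -> mu_edge f = 1%g.
  by move=> Af Tf; rewrite /mu_edge tauP.2 // mulgK mulgV.
move=> Te; have [/treeA->//|nAe] := pselect (A e).
rewrite -[e]barK mu_edge_bar treeA ?invg1 //; last exact: maximal_tree_bar.
by apply/orA; rewrite barK.
Qed.

Lemma mu_edge_conj e :
  (mu_edge e * (tau (ext e) * sgQ e) = tau (org e) * sgQ (bar e))%g.
Proof. by rewrite /mu_edge -!mulgA mulKg mulVg mulg1. Qed.

Lemma glR_sgQ e :
  glmx (glR (sgQ e)) = map_mx intr (sg e).
Proof. by apply/matrixP => i j; rewrite /= !mxE ratr_int. Qed.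

Lemma glR_morphism : monoid.monoid_morphism glR.
Proof. exact: gl_map_morphism. Qed.

Lemma glR_mulE g h : glmx (glR (g * h)%g) = glmx (glR g) *m glmx (glR h).
Proof. by rewrite glR_morphism.2. Qed.

Lemma glR_mu_edge e (x : 'cV[int]_n) :
  glR (mu_edge e) *m (glR (tau (ext e)) *m map_mx intr (sg e *m x)) =
  glR (tau (org e)) *m map_mx intr (sg (bar e) *m x).
Proof.
have mapM f : map_mx (intr : int -> R) (sg f *m x) = glR (sgQ f) *m map_mx intr x.
  by rewrite glR_sgQ map_mxM.
by rewrite !mapM !mulmxA -!glR_mulE -mulgA mu_edge_conj.
Qed.

Lemma mu_letter_rels u w : gog_rel T u w ->
  word_eval mu_letter u = word_eval mu_letter w.
Proof.
rewrite /word_eval; case=> [v x y|e x|e|e Te];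
  rewrite !(big_cons, big_nil) Monoid.mulm1 ?Monoid.mulm1.
- apply: (etrans (affine_transM _ _)); congr Affine.
  by rewrite -mulmxDr -map_mxD.
- by apply: (etrans (affine_conj _ _)); congr Affine; exact: glR_mu_edge.
- apply: (etrans (affine_linM _ _)).
  by rewrite -glR_morphism.2 mu_edge_bar mulgV glR_morphism.1.
- by rewrite /mu_letter /= mu_edge_tree // glR_morphism.1.
Qed.

Lemma mu_morphism : monoid.monoid_morphism mu.
Proof. exact: pres_lift_morphism mu_letter_rels. Qed.

Lemma mu_gv v x : mu (gv T v x) =
  Affine (glR (tau v) *m map_mx (intr : int -> R) x) 1%g.
Proof. exact: (pres_lift_gen mu_letter_rels). Qed.

Lemma mu_gt e : mu (gt T e) = Affine 0 (glR (mu_edge e)).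
Proof. exact: (pres_lift_gen mu_letter_rels). Qed.

Definition Hd : set G := generated (gt T @` (A `\` T)).

(* mu(H_d), as a subgroup of GL_n(R). *)
Definition muHd : set (GL R n) :=
  [set M | exists2 h, Hd h & mu h = Affine 0 M].

Lemma Hd_gt e : Hd (gt T e).
Proof.
have [H1 _ HV] := generated_subgroup (gt T @` (A `\` T)).
have [Te|nTe] := pselect (T e); first by rewrite gt_tree.
have HA f : A f -> ~ T f -> Hd (gt T f).
  by move=> Af nTf; apply: sub_generated; exists f.
have [Ae|nAe] := pselect (A e); first exact: HA.
rewrite -[e]barK gt_bar; apply: HV; apply: HA; first by apply/orA; rewrite barK.
by move/(maximal_tree_bar maxT); rewrite barK.
Qed.

Lemma muHd_subgroup : is_subgroup muHd.
Proof.
have [H1 HM HV] := generated_subgroup (gt T @` (A `\` T)).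
split=> [|M N [h Hh hM] [k Hk kN]|M [h Hh hM]].
- by exists 1%g => //; rewrite mu_morphism.1.
- exists (h * k)%g; first exact: HM.
  by rewrite mu_morphism.2 hM kN affine_linM.
- exists h^-1%g; first exact: HV.
  rewrite -affine_linV -hM; apply/esym/mulg1_eq.
  by rewrite -mu_morphism.2 mulgV mu_morphism.1.
Qed.

Lemma muHd_lin g : muHd (lin (mu g)).
Proof.
have [m1 mM mV] := muHd_subgroup.
rewrite -[g]pres_classE; elim: (repr g) => [|[l b] u IH].
  by rewrite -[pres_class _ _]/(1%g : G) mu_morphism.1.
rewrite -cat1s pres_classM mu_morphism.2 linM; apply: mM => //.
have lin_gen k : muHd (lin (mu (pres_gen (gog_rel T) k))).
  case: k => [[v x]|e]; first by rewrite mu_gv.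
  by rewrite mu_gt; exists (gt T e); [exact: Hd_gt|rewrite mu_gt].
case: b; first exact: lin_gen.
rewrite pres_class_inv.
suff -> : lin (mu (pres_gen (gog_rel T) l)^-1%g) =
          (lin (mu (pres_gen (gog_rel T) l)))^-1%g by exact/mV.
apply/esym/mulg1_eq.
by rewrite -linM -mu_morphism.2 mulgV mu_morphism.1.
Qed.

(* The topological space underlying R^n ><| mu(H_d), with mu(H_d) discrete. *)
Definition affine_Hd : topologicalType :=
  ('cV[R]_n * discrete_topology (set_type muHd))%type.

Definition mu_Hd (g : G) : affine_Hd :=
  (trans (mu g), SigSub (mem_set (muHd_lin g))).

Definition iota_closure : set (graph_aut (bs_tree T)) :=
  closure (range (@bs_iota _ _ T)).

Lemma iota_closure_subproof g : iota_closure (bs_iota g).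
Proof. by apply: subset_closure; exists g. Qed.

Definition iota_mu_target : topologicalType :=
  (set_type iota_closure * affine_Hd)%type.

Definition iota_mu (g : G) : iota_mu_target :=
  (SigSub (mem_set (@iota_closure_subproof g)), mu_Hd g).

End Mu.

(* Properness of a map from a set with the discrete topology, whose compact
   subsets are the finite ones. *)
Definition discrete_proper (G : Type) (Z : topologicalType) (f : G -> Z) : Prop :=
  forall K : set Z, compact K -> finite_set (f @^-1` K).

(* Main.v *)
Require Import Defs.
From mathcomp Require Import all_boot all_order all_algebra.
From mathcomp Require Import all_classical all_reals all_analysis.

(** Properness comes from looking at a single vertex p of the Bass-Serre tree,
    the coset G_{v0}. Let K be a compact subset of the target. Evaluation of
    automorphisms at p is continuous with values in a discrete set, so it maps
    K to a finite set of vertices ([compact_discrete_finite],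
    [orbit_map_continuous]). The stabiliser of p is G_{v0}, hence the g with
    (iota g, mu g) in K lie in finitely many cosets h G_{v0}
    ([act_base_vertexP]). On one such coset, the translation part of mu (h x) is
    an injective affine function of x in G_{v0} = Z^n ([trans_mu_coset]). As K is
    compact, this translation part is bounded, which leaves finitely many
    integer vectors x ([finite_lattice_points]). *)

Set Implicit Arguments.
Unset Strict Implicit.
Unset Printing Implicit Defensive.

Import Order.TTheory GRing.Theory Num.Theory.
Import numFieldNormedType.Exports.
Local Open Scope classical_set_scope.
Local Open Scope ring_scope.

Lemma compact_discrete_finite (D : discreteTopologicalType) (K : set D) :
  compact K -> finite_set K.
Proof.
(* The sets that are cofinite in K have no cluster point; they would form a
   proper filter if K were infinite. *)
move=> cK; apply: contrapT => infK.
pose F : set_system D := [set A | finite_set (K `\` A)].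
have FF : Filter F.
  split=> [|P Q fP fQ|P Q PQ]; rewrite /F /=.
  - by rewrite setDT.
  - by rewrite setDIr finite_setU.
  - by apply: sub_finite_set => x [Kx nQ]; split=> // /PQ.
have PF : ProperFilter F by split=> //; rewrite /F /= setD0.
have [|x [Kx clx]] := cK F PF; first by rewrite /F /= setDv.
have [|y [/= ynx yx]] := clx (~` [set x]) [set x] _ (discrete_set1 x).
  by rewrite /F /= setDE setCK; exact/finite_setIr/finite_set1.
exact: ynx.
Qed.

Lemma finite_bounded_intvec (n N : nat) :
  finite_set [set x : 'cV[int]_n | forall i, `|x i 0| <= N%:Z].
Proof.
(* Shifting by N identifies the integers in [-N, N] with 'I_(2N+1). *)
pose f (y : 'cV['I_(N + N).+1]_n) : 'cV[int]_n := \col_i ((y i 0)%:Z - N%:Z).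
apply: sub_finite_set (finite_image f (finite_finset (X := setT))) => x /= xN.
exists (\col_i inord (absz (x i 0 + N%:Z))) => //.
apply/colP => i; rewrite !mxE; have /= := xN i.
rewrite ler_norml => /andP[xl xr].
have x0 : 0 <= x i 0 + N%:Z by rewrite -(addNr N%:Z) lerD2r.
rewrite inordK ?gez0_abs ?addrK // ltnS -lez_nat gez0_abs // PoszD lerD2r.
exact: xr.
Qed.

Section LatticePoints.
Variables (R : realType) (n : nat).
Implicit Types (B : set 'cV[R]_n) (M : 'M[R]_n).

Lemma bounded_mulmx B M : bounded_set B ->
  exists N : nat, forall x i, B x -> `|(M *m x) i 0| <= N%:R.
Proof.
case/pinfty_ex_gt0 => b b0 Bb.
pose c : R := \sum_(i < n) \sum_(j < n) `|M i j|.
exists (Num.bound (c * b)) => x i Bx.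
have c0 : 0 <= c by rewrite sumr_ge0 // => k _; rewrite sumr_ge0.
apply/ltW/(le_lt_trans _ (archi_boundP (mulr_ge0 c0 (ltW b0)))).
have xb j : `|x j 0| <= b.
  apply: le_trans (Bb x Bx); rewrite [leRHS]/Num.norm /= mx_normrE.
  by apply/bigmax_geP; right => /=; exists (j, 0).
rewrite mxE (le_trans (ler_norm_sum _ _ _)) //.
apply: (@le_trans _ _ (\sum_j `|M i j| * b)).
  by apply: ler_sum => j _; rewrite normrM ler_wpM2l.
rewrite -mulr_suml ler_wpM2r ?(ltW b0) // /c [leRHS](bigD1 i) //= lerDl.
by rewrite sumr_ge0 // => k _; rewrite sumr_ge0.
Qed.

(** Applying M^-1 turns the condition into a bound on x itself. *)
Lemma finite_lattice_points B M (c : 'cV[R]_n) : compact B -> M \in unitmx ->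
  finite_set [set x : 'cV[int]_n | B (c + M *m map_mx intr x)].
Proof.
move=> /compact_bounded Bb uM.
have [N NP] := bounded_mulmx (invmx M) Bb.
have [k kP] := bounded_mulmx (invmx M) (compact_bounded (@compact_set1 _ c)).
apply: sub_finite_set (@finite_bounded_intvec n (N + k)%N) => x /= Bx i.
rewrite -(ler_int R) -pmulrn natrD intr_norm.
have -> : (x i 0)%:~R =
    (invmx M *m (c + M *m map_mx intr x)) i 0 - (invmx M *m c) i 0 :> R.
  by rewrite mulmxDr mulKmx // !mxE addrAC subrr add0r.
by rewrite (le_trans (ler_normB _ _)) // lerD ?NP ?kP.
Qed.

End LatticePoints.

Section Properness.
Variables (R : realType) (n : nat) (X : Zn_graph n).
Variables (T A : set (edge X)) (v0 : vert X) (tau : vert X -> GL rat n).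
Hypotheses (maxT : maximal_tree T) (orA : orientation A).
Hypothesis tauP : tree_family T A v0 tau.
Local Notation G := (fund_group T).
Local Notation target := (iota_mu_target R T A tau).
Local Notation mu := (@mu R n X T tau).

Lemma base_vertex_subproof (v : vert X) : bs_vertS (v, @Gv _ _ T v).
Proof. by exists 1%g; rewrite lcoset1. Qed.
Definition base_vertex (v : vert X) : vert (bs_tree T) :=
  SigSub (mem_set (base_vertex_subproof v)).

(** The base vertex over v is the trivial coset G_v, which is its own stabiliser
    in G; a vertex h G_v is thus reached from it exactly by the elements of
    that coset. *)
Lemma act_base_vertexP (v : vert X) (g h : G) :
  act_vert g (base_vertex v) = act_vert h (base_vertex v) ->
  exists x, g = (h * gv T v x)%g.
Proof.
move/(congr1 (fun y => (val y).2)) => /= gh.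
have : lcoset h (Gv v) g.
  by rewrite -gh; exists 1%g; [exists 0 => //; exact: gv0|rewrite mulg1].
by case=> _ [x _ <-] <-; exists x.
Qed.

Lemma trans_mu_coset (v : vert X) (h : G) (x : 'cV[int]_n) :
  trans (mu (h * gv T v x)%g) =
  trans (mu h) + (lin (mu h) *m glR R (tau v)) *m map_mx intr x.
Proof.
by rewrite (mu_morphism R maxT orA tauP).2 (mu_gv R maxT orA tauP) /= mulmxA.
Qed.

Definition orbit_map (y : vert (bs_tree T)) (p : target) :
    discrete_topology (vert (bs_tree T)) :=
  (val (val p.1)).1 y.

Lemma orbit_map_continuous y : continuous (orbit_map y).
Proof.
have cval (S : topologicalType) (B : set S) : continuous (val : set_type B -> S).
  exact: initial_continuous.
move=> p; apply: (@continuous_comp _ _ _ (fun p : target => (val (val p.1)).1)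
  (fun f : {ptws vert (bs_tree T) -> discrete_topology _} => f y)); last first.
  exact: proj_continuous.
apply: (@continuous_comp _ _ _ (fun p : target => val (val p.1)) fst); last first.
  exact: cvg_fst.
apply: (@continuous_comp _ _ _ (fun p : target => val p.1)); last exact: cval.
apply: (@continuous_comp target _ _ fst); [exact: cvg_fst|exact: cval].
Qed.

Lemma trans_part_continuous : continuous (fun p : target => p.2.1).
Proof.
move=> p; apply: (@continuous_comp _ _ _ snd fst); first exact: cvg_snd.
exact: cvg_fst.
Qed.

Lemma iota_mu_proper : discrete_proper (iota_mu R maxT orA tauP).
Proof.
move=> K cK.
have imK (U : topologicalType) (f : target -> U) :
    continuous f -> compact (f @` K).
  by move=> cf; apply: continuous_compact cK; exact: continuous_subspaceT.
have /compact_discrete_finite finV :=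
  imK _ _ (@orbit_map_continuous (base_vertex v0)).
have cB := imK _ _ trans_part_continuous.
set V := _ @` K in finV; set B := _ @` K in cB.
pose F y : set G := [set g | act_vert g (base_vertex v0) = y /\ B (trans (mu g))].
apply: (@sub_finite_set _ _ (\bigcup_(y in V) F y)) => [g Kg|].
  exists (act_vert g (base_vertex v0)); first by exists (iota_mu R maxT orA tauP g).
  by split=> //; exists (iota_mu R maxT orA tauP g).
apply: bigcup_finite => // y _.
have [[h [hy _]]|F0] := pselect (F y !=set0); last first.
  by apply: sub_finite_set (finite_set0 G) => g Fg; apply: F0; exists g.
have uM : lin (mu h) *m glR R (tau v0) \in unitmx by rewrite unitmx_mul !glmxP.
have := finite_image (fun x => h * gv T v0 x)%g
  (finite_lattice_points (trans (mu h)) cB uM).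
apply: sub_finite_set => g [gy Bg].
have [x gE] : exists x, g = (h * gv T v0 x)%g.
  by apply: act_base_vertexP; rewrite gy hy.
by exists x => //=; rewrite -trans_mu_coset -gE.
Qed.

End Properness.

Theorem proposition1p5 (R : realType) (n : nat) (X : Zn_graph n)
    (T A : set (edge X)) (v0 : vert X) (tau : vert X -> GL rat n)
    (n_gt0 : (1 <= n)%N)
    (finX : finite_graph X)
    (conX : connected_graph X)
    (maxT : maximal_tree T)
    (orA : orientation A)
    (tauP : tree_family T A v0 tau) :
  discrete_proper (iota_mu R maxT orA tauP).
Proof. exact: iota_mu_proper. Qed.
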